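(* Let $G$ be a $\sigma$-compact locally compact Abelian group, let $\Omega$ be a compact Hausdorff space, let $\alpha:G\times\Omega\to\Omega$ be a continuous action, and let $m$ be an $\alpha$-invariant probability measure on $\Omega$. Let $T$ be the unitary representation of $G$ on $L^2(\Omega,m)$ given by $(T^th)(\omega)=h(\alpha_{-t}(\omega))$. Then the following assertions are equivalent: (a) $T$ has pure point spectrum, i.e. $\mathcal{H}_{pp}(T)=L^2(\Omega,m)$; (b) there exists a linear subspace $\mathcal{V}\subset\mathcal{H}_{pp}(T)\cap C(\Omega)$ which separates the points of $\Omega$.
   Context: $C(\Omega)$ is the space of complex continuous functions on $\Omega$. Probability measures on $\Omega$ are regular Borel. A nonzero $h\in L^2(\Omega,m)$ is an eigenfunction of $T$ if there is a character $\hat s\in\widehat G$ with $T^th=(\hat s,t)h$ for every $t\in G$. $\mathcal{H}_{pp}(T)$ denotes the closure in $L^2(\Omega,m)$ of the linear span of all eigenfunctions of $T$. $\mathcal{H}_{pp}(T)\cap C(\Omega)$ means the set of continuous functions whose class in $L^2(\Omega,m)$ lies in $\mathcal{H}_{pp}(T)$. *)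

(* Defs.v *)
From HB Require Import structures.
From mathcomp Require Import all_boot all_order all_algebra.
From mathcomp Require Import complex.
From mathcomp Require Import all_classical all_reals all_analysis.

Set Implicit Arguments.
Unset Strict Implicit.
Unset Printing Implicit Defensive.

Import Order.TTheory GRing.Theory Num.Theory.
Import numFieldNormedType.Exports.

Local Open Scope classical_set_scope.
Local Open Scope ring_scope.
Local Open Scope complex_scope.

(* The complex numbers over [R] with their usual topology; the tag [^o] is what
   makes MathComp-Analysis find it, together with the structure of a module of
   [R[i]] over itself. *)
Notation Cplx R := ((R[i])^o).

(* Measurable types are pointed in MathComp-Analysis, hence [ptopologicalType]
   for the spaces carrying a measure; a space with a probability measure is
   nonempty anyway. *)
Notation borel X := (g_sigma_algebraType (@open X)).

Definition sigma_compact (X : topologicalType) : Prop :=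
  exists K : nat -> set X,
    (forall n, compact (K n)) /\ \bigcup_n K n = [set: X].

Definition separates_points (X Y : Type) (V : set (X -> Y)) : Prop :=
  forall x y : X, x <> y -> exists2 f, V f & f x <> f y.

Definition regular_measure (R : realType) (X : ptopologicalType)
    (m : {measure set (borel X) -> \bar R}) : Prop :=
  forall A : set (borel X), measurable A ->
    m A = ereal_inf [set m U | U in [set U : set X | open U /\ A `<=` U]] /\
    m A = ereal_sup [set m K | K in [set K : set X |
                       compact K /\ measurable (K : set (borel X)) /\ K `<=` A]].

Section Action.
Variables (G : topologicalZmodType) (X : ptopologicalType).

Definition continuous_action (alpha : G -> X -> X) : Prop :=
  [/\ continuous (fun p : G * X => alpha p.1 p.2),
      forall x, alpha 0 x = x &
      forall s t x, alpha (s + t) x = alpha s (alpha t x)].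

Definition invariant_measure (R : realType) (alpha : G -> X -> X)
    (m : {measure set (borel X) -> \bar R}) : Prop :=
  forall (t : G) (A : set (borel X)), measurable A ->
    m (alpha t @^-1` A) = m A.

Definition koopman (R : realType) (alpha : G -> X -> X) (t : G)
    (h : X -> Cplx R) : X -> Cplx R :=
  fun x => h (alpha (- t) x).

End Action.

Definition is_character (R : realType) (G : topologicalZmodType)
    (chi : G -> Cplx R) : Prop :=
  [/\ continuous chi,
      forall t, `|chi t| = 1 &
      forall s t, chi (s + t) = chi s * chi t].

Section LinearSpan.
Variables (K : nzRingType) (E : lmodType K).

Definition is_subspace (V : set E) : Prop :=
  V 0 /\ forall (a : K) f g, V f -> V g -> V (a *: f + g).

Definition linear_span (S : set E) : set E :=
  [set g | exists n (c : 'I_n -> K) (h : 'I_n -> E),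
     (forall i, S (h i)) /\ g = \sum_(i < n) c i *: h i].

End LinearSpan.

(* Elements of L^2(X, m) are handled through Borel representatives: [L2],
   [eigenfunction] and [Hpp] contain with a function every Borel function that
   is m-almost everywhere equal to it (as soon as each [T t] respects almost
   everywhere equality, e.g., [koopman] for an invariant measure), and equality
   (resp. non-vanishing) in L^2(X, m) is equality (resp. non-vanishing) modulo [%[ae m]]. *)
Section SquareIntegrable.
Variables (R : realType) (X : ptopologicalType).
Variable m : {measure set (borel X) -> \bar R}.

Definition L2norm (h : X -> Cplx R) : \bar R :=
  Lnorm m 2%:E (fun x : borel X => (ComplexField.Normc.normc (h x))%:E).

Definition L2 : set (X -> Cplx R) :=
  [set h : X -> Cplx R |
    [/\ measurable_fun [set: borel X] (fun x : borel X => complex.Re (h x)),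
        measurable_fun [set: borel X] (fun x : borel X => complex.Im (h x)) &
        (L2norm h < +oo)%E]].

Definition L2closure (S : set (X -> Cplx R)) : set (X -> Cplx R) :=
  [set h : X -> Cplx R | L2 h /\
     forall e : R, 0 < e -> exists2 g, S g & (L2norm (h - g)%R < e%:E)%E].

Variable G : topologicalZmodType.
Variable T : G -> (X -> Cplx R) -> (X -> Cplx R).

Definition eigenfunction (h : X -> Cplx R) : Prop :=
  [/\ L2 h,
      ~ ((h : borel X -> Cplx R) = cst 0 %[ae m]) &
      exists2 chi : G -> Cplx R, is_character chi &
        forall t, (T t h : borel X -> Cplx R) = chi t *: h %[ae m]].

Definition Hpp : set (X -> Cplx R) := L2closure (linear_span eigenfunction).

End SquareIntegrable.

(* Main.v *)
Require Import Defs.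
From HB Require Import structures.
From mathcomp Require Import all_boot all_order all_algebra.
From mathcomp Require Import complex.
From mathcomp Require Import all_classical all_reals all_analysis.
From mathcomp Require Import measurable_realfun.
From mathcomp Require Import finmap ring lra.

Set Implicit Arguments.
Unset Strict Implicit.
Unset Printing Implicit Defensive.

Import Order.TTheory GRing.Theory Num.Theory.
Import numFieldNormedType.Exports.
Import HBSimple HBNNSimple.

Local Open Scope classical_set_scope.
Local Open Scope ring_scope.

(** (a) => (b): take [V] to be all continuous functions and apply Urysohn's
    lemma.
    (b) => (a): the modulus of an eigenfunction is invariant, so truncating it
    yields a bounded eigenfunction with the same character; hence [Hpp] is the
    closure of the span of the bounded eigenfunctions, which is a unital
    *-algebra.  The Borel sets whose indicator lies in [Hpp] therefore form an
    algebra of sets, and it contains the sublevel sets of every bounded real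
    function in [Hpp], because [(1 - t ^ n) ^ (n 2 ^ n)] converges pointwise on
    [0, 1] to the indicator of [t < 1/2].  As [V] separates points, compactness
    shows that this algebra separates disjoint compact sets, and regularity of
    the measure then gives all Borel sets, hence all of [L2].  This replaces the
    Stone-Weierstrass theorem and the density of the continuous functions. *)

(** * Square-integrable complex functions *)

(** The norm of [R[i]] takes its values in [R[i]]; this squared modulus is real and polynomial in
    the two parts, hence fit for integration and for [ring] and [nra]. *)
Definition sqnorm (R : realType) (z : R[i]) : R :=
  (complex.Re z) ^+ 2 + (complex.Im z) ^+ 2.

Section Sqnorm.
Variable R : realType.
Implicit Types a b : R[i].

Lemma sqnorm_ge0 a : 0 <= sqnorm a.
Proof. by rewrite addr_ge0 ?sqr_ge0. Qed.

Lemma normcE a : ComplexField.Normc.normc a = Num.sqrt (sqnorm a).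
Proof. by case: a. Qed.

Lemma sqnormM a b : sqnorm (a * b) = sqnorm a * sqnorm b.
Proof. by case: a b => [x y] [z t]; rewrite /sqnorm/=; ring. Qed.

(** By the parallelogram law the two sides differ by the squared modulus of [a - b]. *)
Lemma sqnormD a b : sqnorm (a + b) <= 2 * sqnorm a + 2 * sqnorm b.
Proof. case: a b => [x y] [z t]; rewrite /sqnorm/=.
by have := sqr_ge0 (x - z); have := sqr_ge0 (y - t); nra. Qed.

Lemma sqnormN a : sqnorm (- a) = sqnorm a.
Proof. by case: a => x y; rewrite /sqnorm/=; ring. Qed.

Lemma sqnormJ a : sqnorm (conjc a) = sqnorm a.
Proof. by case: a => x y; rewrite /sqnorm/=; ring. Qed.

Lemma sqnorm_real (x : R) : sqnorm (x%:C)%C = x ^+ 2.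
Proof. by rewrite /sqnorm/=; ring. Qed.

Lemma sqnorm1 : sqnorm (1 : R[i]) = 1.
Proof. by rewrite /sqnorm/=; ring. Qed.

Lemma sqnorm0 : sqnorm (0 : R[i]) = 0.
Proof. by rewrite /sqnorm/=; ring. Qed.

Lemma sqnorm_norm1 a : `|a| = 1 -> sqnorm a = 1.
Proof.
move=> a1; apply: complexI.
have /(congr1 (fun z => z ^+ 2)) := a1.
by rewrite -add_Re2_Im2 expr1n => ->.
Qed.

End Sqnorm.

Definition cmeasurable (R : realType) (X : ptopologicalType)
    (h : X -> Cplx R) : Prop :=
  measurable_fun [set: borel X] (fun x : borel X => complex.Re (h x)) /\
  measurable_fun [set: borel X] (fun x : borel X => complex.Im (h x)).

Section ComplexMeasurable.
Variables (R : realType) (X : ptopologicalType).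
Implicit Types f g h : X -> Cplx R.

Lemma cmeasurable_cst (c : R[i]) : cmeasurable (fun _ : X => c : Cplx R).
Proof. by split; exact: measurable_cst. Qed.

Lemma cmeasurableD f g : cmeasurable f -> cmeasurable g -> cmeasurable (f + g).
Proof.
move=> [fr fi] [gr gi]; split.
- rewrite (_ : (fun _ => _) = (fun x : borel X => complex.Re (f x) + complex.Re (g x))).
    exact: measurable_funD.
  by apply/funext => x; rewrite /= /GRing.add/=; case: (f x) (g x) => [? ?] [? ?].
- rewrite (_ : (fun _ => _) = (fun x : borel X => complex.Im (f x) + complex.Im (g x))).
    exact: measurable_funD.
  by apply/funext => x; rewrite /= /GRing.add/=; case: (f x) (g x) => [? ?] [? ?].
Qed.

Lemma cmeasurableM f g : cmeasurable f -> cmeasurable g ->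
  cmeasurable (fun x => f x * g x).
Proof.
move=> [fr fi] [gr gi]; split.
- rewrite (_ : (fun _ => _) = (fun x : borel X =>
    complex.Re (f x) * complex.Re (g x) - complex.Im (f x) * complex.Im (g x))).
    by apply: measurable_funB; apply: measurable_funM.
  by apply/funext => x /=; case: (f x) (g x) => [? ?] [? ?].
- rewrite (_ : (fun _ => _) = (fun x : borel X =>
    complex.Re (f x) * complex.Im (g x) + complex.Im (f x) * complex.Re (g x))).
    by apply: measurable_funD; apply: measurable_funM.
  by apply/funext => x /=; case: (f x) (g x) => [? ?] [? ?].
Qed.

Lemma cscaleE (c : R[i]) f x : (c *: f) x = c * f x.
Proof. by []. Qed.

Lemma cmeasurableZ (c : R[i]) f : cmeasurable f -> cmeasurable (c *: f).
Proof. by move=> mf; exact: (cmeasurableM (cmeasurable_cst c) mf). Qed.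

Lemma cmeasurableB f g : cmeasurable f -> cmeasurable g -> cmeasurable (f - g).
Proof.
move=> mf mg; apply: cmeasurableD => //.
by rewrite -scaleN1r; exact: cmeasurableZ.
Qed.

Lemma cmeasurableJ f : cmeasurable f -> cmeasurable (fun x => conjc (f x)).
Proof.
move=> [fr fi]; split.
- by rewrite (_ : (fun _ => _) = (fun x : borel X => complex.Re (f x)))//;
    apply/funext => x; case: (f x).
- rewrite (_ : (fun _ => _) = (fun x : borel X => - complex.Im (f x))).
    exact: measurableT_comp.
  by apply/funext => x; case: (f x).
Qed.

Lemma cmeasurable_real (u : X -> R) :
  cmeasurable (fun x => (u x)%:C%C : Cplx R) <->
  measurable_fun [set: borel X] (u : borel X -> R).
Proof.
by split=> [[]|mu].
Qed.

Lemma measurable_sqnorm f : cmeasurable f ->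
  measurable_fun [set: borel X] (fun x : borel X => (sqnorm (f x))%:E).
Proof.
move=> [fr fi]; apply/measurable_EFinP.
by apply: measurable_funD; apply: measurable_funX.
Qed.

End ComplexMeasurable.

Arguments cmeasurable_cst {R X} c.

Section SquareIntegral.
Variables (R : realType) (X : ptopologicalType).
Variable m : {measure set (borel X) -> \bar R}.
Implicit Types f g h : X -> Cplx R.

(** Square of the L^2 norm ([L2norm_energy]); estimates and limits are carried out on it to avoid
    roots. *)
Definition energy h : \bar R := (\int[m]_(x in setT) (sqnorm (h x))%:E)%E.

Lemma energy_ge0 h : (0 <= energy h)%E.
Proof. by apply: integral_ge0 => x _; rewrite lee_fin sqnorm_ge0. Qed.

Lemma L2norm_energy h : L2norm m h = sqrte (energy h).
Proof.
rewrite /L2norm Lnorm.unlock poweR12_sqrt; last first.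
  by apply: integral_ge0 => x _; exact: poweR_ge0.
congr sqrte; apply: eq_integral => x _.
rewrite normcE abse_EFin ger0_norm ?sqrtr_ge0// poweR_EFin.
by rewrite powR_mulrn ?sqrtr_ge0// sqr_sqrtr ?sqnorm_ge0.
Qed.

Lemma L2norm_lt h (e : R) : 0 < e ->
  (L2norm m h < e%:E)%E = (energy h < (e ^+ 2)%:E)%E.
Proof.
move=> e0; rewrite L2norm_energy; have := energy_ge0 h.
case: (energy h) => [r| |]//=; rewrite ?lee_fin => r0.
by rewrite !lte_fin -[in RHS](sqr_sqrtr r0) ltr_pXn2r// nnegrE ?sqrtr_ge0// ltW.
Qed.

Lemma L2P h : L2 m h <-> cmeasurable h /\ (energy h < +oo)%E.
Proof.
rewrite /L2 /= /cmeasurable L2norm_energy.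
suff -> : (sqrte (energy h) < +oo)%E = (energy h < +oo)%E by split=> [[]|[[]]].
by have := energy_ge0 h; case: (energy h) => [r| |]//= _; rewrite !ltry.
Qed.

Lemma le_energy f g (C : R) : cmeasurable f -> cmeasurable g ->
  0 <= C -> (forall x, sqnorm (f x) <= C * sqnorm (g x)) ->
  (energy f <= C%:E * energy g)%E.
Proof.
move=> mf mg C0 fg; rewrite -ge0_integralZl//; first last.
- by move=> x _; rewrite lee_fin sqnorm_ge0.
- exact: measurable_sqnorm.
apply: ge0_le_integral => //.
- by move=> x _; rewrite lee_fin sqnorm_ge0.
- exact: measurable_sqnorm.
- by apply: measurable_funeM; exact: measurable_sqnorm.
- by move=> x _; rewrite lee_fin fg.
Qed.

(** Integrated form of [sqnormD]: a triangle inequality for squared norms, at the price of a factor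
    2. *)
Lemma energyD f g : cmeasurable f -> cmeasurable g ->
  (energy (f + g)%R <= 2%:E * energy f + 2%:E * energy g)%E.
Proof.
move=> mf mg; have mf2 := measurable_sqnorm mf; have mg2 := measurable_sqnorm mg.
rewrite -!ge0_integralZl//; try by move=> x _; rewrite lee_fin sqnorm_ge0.
rewrite -ge0_integralD//; first last.
- exact: measurable_funeM.
- by move=> x _; rewrite mule_ge0 ?lee_fin ?sqnorm_ge0.
- exact: measurable_funeM.
- by move=> x _; rewrite mule_ge0 ?lee_fin ?sqnorm_ge0.
apply: ge0_le_integral => //.
- by move=> x _; rewrite lee_fin sqnorm_ge0.
- by apply: measurable_sqnorm; exact: cmeasurableD.
- by apply: emeasurable_funD; exact: measurable_funeM.
- by move=> x _; rewrite -!EFinM -EFinD lee_fin sqnormD.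
Qed.

Lemma ae_eq_energy f g : cmeasurable f -> cmeasurable g ->
  (f : borel X -> Cplx R) = g %[ae m] -> energy f = energy g.
Proof.
move=> mf mg fg; apply: ae_eq_integral => //; try exact: measurable_sqnorm.
by apply: filterS fg => x /= fgx xT; rewrite fgx.
Qed.

Lemma energy0 : energy 0 = 0%E.
Proof. by apply: integral0_eq => x _; rewrite sqnorm0. Qed.

End SquareIntegral.

Arguments energy {R X} m h%_ring_scope.

(** * Subspaces and linear spans *)

Section Subspace.
Variables (K : nzRingType) (E : lmodType K).
Implicit Types S V : set E.

Lemma subspaceZ V : is_subspace V -> forall a f, V f -> V (a *: f).
Proof. by move=> [V0 VL] a f Vf; rewrite -[_ *: _]addr0; exact: VL. Qed.

Lemma subspaceD V : is_subspace V -> forall f g, V f -> V g -> V (f + g).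
Proof. by move=> [V0 VL] f g Vf Vg; rewrite -[f]scale1r; exact: VL. Qed.

Lemma subspaceB V : is_subspace V -> forall f g, V f -> V g -> V (f - g).
Proof.
by move=> sV f g Vf Vg; rewrite -scaleN1r; apply: subspaceD (subspaceZ _ _ _).
Qed.

Lemma subspace_sum V I (r : seq I) (F : I -> E) :
  is_subspace V -> (forall i, V (F i)) -> V (\sum_(i <- r) F i).
Proof.
by move=> sV VF; apply: big_ind => //; [case: sV|exact: subspaceD].
Qed.

(** This is the induction principle for spans, used below to extend properties of eigenfunctions to
    their combinations. *)
Lemma linear_span_min S V : is_subspace V -> S `<=` V -> linear_span S `<=` V.
Proof.
move=> sV SV _ [n [c [h [Sh ->]]]].
by apply: subspace_sum => // i; apply: subspaceZ => //; exact: SV.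
Qed.

Lemma sub_linear_span S : S `<=` linear_span S.
Proof.
move=> h Sh; exists 1, (fun=> 1), (fun=> h); split => //.
by rewrite big_ord1 scale1r.
Qed.

Lemma linear_span_subspace S : is_subspace (linear_span S).
Proof.
split.
  exists 0, (fun=> 0), (fun=> 0); split; first by case.
  by rewrite big_ord0.
move=> a _ _ [n [c [h [Sh ->]]]] [n' [c' [h' [Sh' ->]]]].
(* Concatenation of the two families, [a] being absorbed into the coefficients of the first. *)
exists (n + n')%N,
  (fun k : 'I_(n + n') =>
     match fintype.split k with inl i => a * c i | inr j => c' j end),
  (fun k : 'I_(n + n') =>
     match fintype.split k with inl i => h i | inr j => h' j end); split.
  by move=> k; case: (fintype.split k).
rewrite big_split_ord/= scaler_sumr; congr (_ + _); apply: eq_bigr => i _.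
- by have /= -> := unsplitK (inl i : 'I_n + 'I_n')%type; rewrite scalerA.
- by have /= -> := unsplitK (inr i : 'I_n + 'I_n')%type.
Qed.

End Subspace.

(** * Closed subspaces of L^2 *)

Section L2Closure.
Variables (R : realType) (X : ptopologicalType).
Variable m : probability (borel X) R.
Implicit Types f g h : X -> Cplx R.

Lemma L2_subspace : is_subspace (L2 m : set (X -> Cplx R)).
Proof.
split; first by apply/L2P; split; [exact: cmeasurable_cst|rewrite energy0].
move=> a f g /L2P[mf ef] /L2P[mg eg]; apply/L2P; split.
  by apply: cmeasurableD => //; exact: cmeasurableZ.
apply: (le_lt_trans (energyD _ (cmeasurableZ a mf) mg)).
apply: lte_add_pinfty; apply: lte_mul_pinfty => //.
apply: (@le_lt_trans _ _ ((sqnorm a)%:E * energy m f)%E).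
  apply: le_energy => //; [exact: cmeasurableZ|exact: sqnorm_ge0|].
  by move=> x; rewrite -sqnormM.
by apply: lte_mul_pinfty => //; rewrite lee_fin sqnorm_ge0.
Qed.

(** The total mass is 1, so the energy is at most [C]. *)
Lemma L2_bounded f (C : R) : cmeasurable f -> (forall x, sqnorm (f x) <= C) ->
  L2 m f.
Proof.
move=> mf fC; apply/L2P; split=> //.
apply: (@le_lt_trans _ _ (C%:E * energy m (fun=> 1)%R)%E).
  apply: le_energy => //.
    by rewrite (le_trans (sqnorm_ge0 (f point))).
  by move=> x; rewrite sqnorm1 mulr1.
suff -> : energy m (fun=> 1) = 1%E by rewrite mule1 ltry.
rewrite /energy; under eq_integral do rewrite sqnorm1.
by rewrite integral_cst// mul1e; exact: probability_setT.
Qed.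

Lemma L2closureP (S : set (X -> Cplx R)) h : L2closure m S h <->
  L2 m h /\ forall e : R, 0 < e -> exists2 g, S g & (energy m (h - g) <= e%:E)%E.
Proof.
split=> -[hL happ]; split => // e e0.
  have s0 : 0 < Num.sqrt e by rewrite sqrtr_gt0.
  have [g Sg] := happ _ s0; rewrite L2norm_lt// sqr_sqrtr ?ltW// => hg.
  by exists g => //; exact: ltW.
(* Halving [e ^+ 2] turns the weak bound on the energy into the strict bound on the norm. *)
have e20 : 0 < e ^+ 2 / 2 by rewrite divr_gt0 ?exprn_gt0.
have [g Sg hg] := happ _ e20; exists g => //.
rewrite L2norm_lt//; apply: (le_lt_trans hg).
by rewrite lte_fin ltr_pdivrMr// ltr_pMr ?exprn_gt0// ltr1n.
Qed.

Lemma sub_L2closure (S : set (X -> Cplx R)) : S `<=` L2 m -> S `<=` L2closure m S.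
Proof.
move=> SL h Sh; apply/L2closureP; split; first exact: SL.
by move=> e e0; exists h => //; rewrite subrr energy0 lee_fin ltW.
Qed.

Lemma energyD_le f g (d e : R) : cmeasurable f -> cmeasurable g ->
  (energy m f <= d%:E -> energy m g <= e%:E ->
   energy m (f + g)%R <= (2 * d + 2 * e)%:E)%E.
Proof.
move=> mf mg fd ge; apply: (le_trans (energyD _ mf mg)).
rewrite (_ : (2 * d + 2 * e)%:E = (2%:E * d%:E + 2%:E * e%:E)%E)//.
by apply: leeD; apply: lee_pmul => //; exact: energy_ge0.
Qed.

Lemma energyM_le f g (C e : R) : cmeasurable f -> cmeasurable g -> 0 <= C ->
  (forall x, sqnorm (f x) <= C) -> (energy m g <= e%:E)%E ->
  (energy m (fun x => f x * g x)%R <= (C * e)%:E)%E.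
Proof.
move=> mf mg C0 fC ge; apply: (@le_trans _ _ (C%:E * energy m g)%E).
  apply: le_energy => //; first exact: cmeasurableM.
  by move=> x; rewrite sqnormM ler_wpM2r ?sqnorm_ge0.
by rewrite EFinM; apply: lee_pmul => //; exact: energy_ge0.
Qed.

Lemma L2closure_subspace (S : set (X -> Cplx R)) :
  S `<=` L2 m -> is_subspace S -> is_subspace (L2closure m S).
Proof.
move=> SL sS; split; first by apply: sub_L2closure => //; case: sS.
move=> a f g /L2closureP[fL fapp] /L2closureP[gL gapp]; apply/L2closureP; split.
  by case: L2_subspace => _; exact.
move=> e e0.
(* Adding 1 keeps the divisor positive when [a = 0]; each of the two quarters of [e] is doubled by
   [energyD_le]. *)
have a0 : 0 < sqnorm a + 1 by rewrite ltr_wpDl ?sqnorm_ge0.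
have [s Ss fs] := fapp (e / 4 / (sqnorm a + 1)) ltac:(by rewrite !divr_gt0).
have [t St gt] := gapp (e / 4) ltac:(by rewrite divr_gt0).
exists (a *: s + t); first by case: sS => _; exact.
have mfs : cmeasurable (f - s).
  by apply: cmeasurableB; [case/L2P: fL|case/L2P: (SL _ Ss)].
have mgt : cmeasurable (g - t).
  by apply: cmeasurableB; [case/L2P: gL|case/L2P: (SL _ St)].
rewrite opprD addrACA -scalerBr.
have := @energyM_le (fun=> a) (f - s) (sqnorm a + 1) (e / 4 / (sqnorm a + 1))
  (cmeasurable_cst a) mfs  (ltW a0) (fun=> ler_wpDr ler01 (lexx _)) fs.
rewrite mulrC divfK ?gt_eqF// => afs.
apply: le_trans (energyD_le (cmeasurableZ a mfs) mgt afs gt) _.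
by rewrite lee_fin; lra.
Qed.

Lemma L2closureK (S : set (X -> Cplx R)) :
  S `<=` L2 m -> L2closure m (L2closure m S) `<=` L2closure m S.
Proof.
move=> SL f /L2closureP[fL fapp]; apply/L2closureP; split => // e e0.
have [g /L2closureP[gL gapp] fg] := fapp (e / 4) ltac:(by rewrite divr_gt0).
have [s Ss gs] := gapp (e / 4) ltac:(by rewrite divr_gt0).
exists s => //; rewrite -[f](subrK g) -addrA.
have mfg : cmeasurable (f - g).
  by apply: cmeasurableB; [case/L2P: fL|case/L2P: gL].
have mgs : cmeasurable (g - s).
  by apply: cmeasurableB; [case/L2P: gL|case/L2P: (SL _ Ss)].
apply: le_trans (energyD_le mfg mgs fg gs) _.
by rewrite lee_fin; lra.
Qed.

(** Dominated convergence is applied to the squared error, so [g] bounds squares and only has to be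
    integrable. *)
Lemma energy_dominated_cvg (f_ : nat -> X -> Cplx R) f (g : X -> R) :
  (forall n, cmeasurable (f_ n)) -> cmeasurable f ->
  m.-integrable [set: borel X] (fun x : borel X => (g x)%:E) ->
  (forall n x, sqnorm (f x - f_ n x) <= g x) ->
  (forall x, sqnorm (f x - f_ n x) @[n --> \oo] --> (0 : R)) ->
  forall e : R, 0 < e -> exists n, (energy m (f - f_ n)%R <= e%:E)%E.
Proof.
move=> mf_ mf ig fg cvf e e0.
have [_ _] := @dominated_convergence _ _ _ m _ measurableT
  (fun n (x : borel X) => (sqnorm (f x - f_ n x))%:E) (cst 0%E)
  (fun x : borel X => (g x)%:E)
  (fun n => measurable_sqnorm (cmeasurableB mf (mf_ n))) (measurable_cst _)
  ltac:(by apply: aeW => x _; apply: cvg_EFin; [exact: nearW|exact: cvf]) ig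
  ltac:(by apply: aeW => x n _; rewrite gee0_abs ?lee_fin ?sqnorm_ge0).
(* Convergence to 0 in the extended reals makes the energies eventually finite; one index that is
   both finite and within [e] suffices. *)
rewrite integral0 => /fine_cvgP[fin /cvgrPdist_le/(_ _ e0)] cvE.
have [n _ /(_ n (leqnn n))[/= nfin]] := filterI fin cvE.
rewrite sub0r normrN => nE; exists n.
rewrite -[energy _ _]fineK//.
by rewrite lee_fin (le_trans (ler_norm _)).
Qed.

(** It provides the members of closures obtained as limits: of truncations, of polynomials
    approximating a step, and of simple functions. *)
Lemma L2closure_dominated (S : set (X -> Cplx R)) (f_ : nat -> X -> Cplx R) f
    (g : X -> R) :
  S `<=` L2 m -> L2 m f -> (forall n, L2closure m S (f_ n)) ->
  m.-integrable [set: borel X] (fun x : borel X => (g x)%:E) ->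
  (forall n x, sqnorm (f x - f_ n x) <= g x) ->
  (forall x, sqnorm (f x - f_ n x) @[n --> \oo] --> (0 : R)) ->
  L2closure m S f.
Proof.
move=> SL fL Sf_ ig fg cvf; apply: (L2closureK SL); apply/L2closureP; split => // e e0.
have mf_ n : cmeasurable (f_ n) by have /L2closureP[/L2P[]] := Sf_ n.
have [mf _] := (L2P _ _).1 fL.
have [n fn] := energy_dominated_cvg mf_ mf ig fg cvf e0.
by exists (f_ n).
Qed.

End L2Closure.

(** * Bounded eigenfunctions span the pure point space *)

Section Characters.
Variables (R : realType) (G : topologicalZmodType).
Implicit Types chi : G -> Cplx R.

Lemma is_character1 : is_character (fun _ : G => 1 : Cplx R).
Proof.
by split => [|t|s t]; [exact: cst_continuous|rewrite normr1|rewrite mulr1].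
Qed.

Lemma is_characterM chi chi' : is_character chi -> is_character chi' ->
  is_character (fun t => chi t * chi' t).
Proof.
move=> [cc c1 cD] [cc' c1' cD']; split => [t|t|s t].
- by apply: (@cvgM R[i]); [exact: cc|exact: cc'].
- by rewrite normrM c1 c1' mulr1.
- by rewrite cD cD' mulrACA.
Qed.

Lemma is_characterJ chi : is_character chi -> is_character (fun t => conjc (chi t)).
Proof.
move=> [cc c1 cD]; split => [t|t|s t].
- apply/cvgrPdist_le => e e0; have /cvgrPdist_le/(_ _ e0) := cc t.
  by apply: filterS => s /=; rewrite -rmorphB normcJ.
- by rewrite normcJ.
- by rewrite cD rmorphM.
Qed.

End Characters.

(** * Truncation of complex values and complex indicators *)

Section Truncation.
Variable R : realType.

(** Large values are sent to 0 rather than rescaled, with the threshold on the squared modulus; the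
    test depends on the modulus alone, so truncation commutes with multiplication by numbers of
    modulus 1. *)
Definition truncate (N : R) (z : R[i]) : R[i] := if sqnorm z <= N then z else 0.

Lemma truncateM N (c z : R[i]) : sqnorm c = 1 -> truncate N (c * z) = c * truncate N z.
Proof.
by move=> c1; rewrite /truncate sqnormM c1 mul1r; case: ifP; rewrite ?mulr0.
Qed.

Lemma sqnorm_truncate N z : 0 <= N -> sqnorm (truncate N z) <= N.
Proof. by rewrite /truncate => N0; case: ifP; rewrite ?sqnorm0. Qed.

Lemma sqnorm_sub_truncate N z : sqnorm (z - truncate N z) <= sqnorm z.
Proof.
by rewrite /truncate; case: ifP; rewrite ?subrr ?sqnorm0 ?sqnorm_ge0 ?subr0.
Qed.

Lemma truncate_cvg z : sqnorm (z - truncate n%:R z) @[n --> \oo] --> (0 : R).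
Proof.
apply: cvg_near_cst; near=> n.
rewrite /truncate ifT ?subrr ?sqnorm0//.
by near: n; exact: nbhs_infty_ger.
Unshelve. all: by end_near. Qed.

Variable X : ptopologicalType.

Lemma measurable_sublevel (u : X -> R) (c : R) :
  measurable_fun [set: borel X] (u : borel X -> R) ->
  measurable ([set x | u x <= c] : set (borel X)).
Proof.
move=> mu; rewrite -[X in measurable X]setTI.
rewrite (_ : [set x | _] = u @^-1` `]-oo, c]); first exact: mu.
by apply/seteqP; split => x /=; rewrite in_itv.
Qed.

Lemma measurable_strict_sublevel (u : X -> R) (c : R) :
  measurable_fun [set: borel X] (u : borel X -> R) ->
  measurable ([set x | u x < c] : set (borel X)).
Proof.
move=> mu; rewrite -[X in measurable X]setTI.
rewrite (_ : [set x | _] = u @^-1` `]-oo, c[); first exact: mu.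
by apply/seteqP; split => x /=; rewrite in_itv.
Qed.

Definition cindic (E : set X) (x : X) : Cplx R := (\1_E x : R)%:C%C.

Lemma cindicT (E : set X) x : E x -> cindic E x = 1.
Proof. by move=> Ex; rewrite /cindic indicE mem_set. Qed.

Lemma cindicF (E : set X) x : ~ E x -> cindic E x = 0.
Proof. by move=> Ex; rewrite /cindic indicE memNset. Qed.

Lemma cmeasurable_indic (E : set X) : measurable (E : set (borel X)) ->
  cmeasurable (cindic E).
Proof.
by move=> mE; apply/cmeasurable_real; exact: (@measurable_indic _ (borel X)).
Qed.

Lemma cmeasurable_truncate (N : R) (h : X -> Cplx R) : cmeasurable h ->
  cmeasurable (fun x => truncate N (h x) : Cplx R).
Proof.
move=> mh; have mE : measurable ([set x | sqnorm (h x) <= N] : set (borel X)).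
  by apply: measurable_sublevel; apply/measurable_EFinP; exact: measurable_sqnorm.
rewrite (_ : (fun x => _) =
  (fun x => cindic [set x | sqnorm (h x) <= N] x * h x)).
  by apply: cmeasurableM => //; exact: cmeasurable_indic.
apply/funext => x; rewrite /truncate; case: ifPn => hN.
  by rewrite cindicT ?mul1r.
by rewrite cindicF ?mul0r//=; exact/negP.
Qed.

End Truncation.

Arguments cindic {R X} E x.
Arguments cindicT {R X E x} _.
Arguments cindicF {R X E x} _.
Arguments cmeasurable_indic {R X E} _.

Section BoundedEigenfunctions.
Variables (R : realType) (X : ptopologicalType).
Variable m : probability (borel X) R.
Variables (G : topologicalZmodType) (alpha : G -> X -> X).
Implicit Types f g h : X -> Cplx R.

(** Null functions are allowed, unlike in [eigenfunction]: this is what makes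
    the class closed under products and truncations. *)
Definition bounded_eigenfunction h : Prop :=
  [/\ cmeasurable h,
      exists C : R, forall x, sqnorm (h x) <= C &
      exists2 chi : G -> Cplx R, is_character chi &
        forall t, (koopman alpha t h : borel X -> Cplx R) = chi t *: h %[ae m]].

Definition eigenspan : set (X -> Cplx R) := linear_span bounded_eigenfunction.

Lemma bounded_eigenfunction1 : bounded_eigenfunction (fun=> 1).
Proof.
split; first exact: cmeasurable_cst.
  by exists 1 => x; rewrite sqnorm1.
exists (fun=> 1); first exact: is_character1.
by move=> t; apply: aeW => x _; rewrite scale1r.
Qed.

Lemma bounded_eigenfunctionM f g :
  bounded_eigenfunction f -> bounded_eigenfunction g ->
  bounded_eigenfunction (fun x => f x * g x).
Proof.
move=> [mf [C fC] [chi cc fchi]] [mg [C' gC'] [chi' cc' gchi]]; split.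
- exact: cmeasurableM.
- exists (C * C') => x; rewrite sqnormM; apply: ler_pM => //; exact: sqnorm_ge0.
- exists (fun t => chi t * chi' t); first exact: is_characterM.
  move=> t; apply: filterS2 (fchi t) (gchi t) => x /= + + xT => /(_ xT) + /(_ xT).
  rewrite /koopman => -> ->.
  by rewrite !cscaleE mulrACA.
Qed.

Lemma bounded_eigenfunctionJ f : bounded_eigenfunction f ->
  bounded_eigenfunction (fun x => conjc (f x)).
Proof.
move=> [mf [C fC] [chi cc fchi]]; split.
- exact: cmeasurableJ.
- by exists C => x; rewrite sqnormJ.
- exists (fun t => conjc (chi t)); first exact: is_characterJ.
  move=> t; apply: filterS (fchi t) => x /= /[apply]; rewrite /koopman => ->.
  by rewrite !cscaleE rmorphM.
Qed.

(** [koopman] composes on the right and truncation on the left, and [chi t] has modulus 1, so the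
    relation with the character [chi] survives. *)
Lemma truncate_eigenfunction h (N : R) : 0 <= N -> eigenfunction m (koopman alpha) h ->
  bounded_eigenfunction (fun x => truncate N (h x)).
Proof.
move=> N0 [/L2P[mh _] _ [chi cc hchi]]; split.
- exact: cmeasurable_truncate.
- by exists N => x; exact: sqnorm_truncate.
- exists chi => // t; apply: filterS (hchi t) => x /= /[apply]; rewrite /koopman => ->.
  by case: cc => _ c1 _; rewrite truncateM ?(sqnorm_norm1 (c1 t)).
Qed.

Lemma eigenspan_subspace : is_subspace eigenspan.
Proof. exact: linear_span_subspace. Qed.

Lemma eigenspan_bounded f : eigenspan f ->
  cmeasurable f /\ exists C : R, forall x, sqnorm (f x) <= C.
Proof.
pose B : set (X -> Cplx R) :=
  [set f | cmeasurable f /\ exists C : R, forall x, sqnorm (f x) <= C].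
suff : eigenspan `<=` B by exact.
apply: linear_span_min; last by move=> h [].
split; first by split; [exact: cmeasurable_cst|exists 0 => x; rewrite sqnorm0].
move=> a g h [mg [C gC]] [mh [C' hC]]; split.
  by apply: cmeasurableD => //; exact: cmeasurableZ.
exists (2 * (sqnorm a * C) + 2 * C') => x.
apply: (le_trans (sqnormD _ _)); apply: lerD; rewrite ler_pM2l//.
by rewrite sqnormM ler_wpM2l ?sqnorm_ge0.
Qed.

Lemma eigenspan_L2 : eigenspan `<=` L2 m.
Proof. by move=> f /eigenspan_bounded[mf [C fC]]; exact: (L2_bounded m mf fC). Qed.

(** Bilinearity: the minimality of the span is applied once for each factor, which reduces the claim
    to a product of two bounded eigenfunctions. *)
Lemma eigenspanM f g : eigenspan f -> eigenspan g -> eigenspan (fun x => f x * g x).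
Proof.
move=> Ef; have [E0 EL] := eigenspan_subspace.
pose V f : set (X -> Cplx R) := [set g | eigenspan (fun x => f x * g x)].
have sV h : is_subspace (V h).
  split; first by rewrite /V/= (_ : (fun x => _) = 0)//; apply/funext => x; rewrite mulr0.
  move=> a u v Vu Vv; rewrite /V/=.
  rewrite (_ : (fun x => _) = a *: (fun x => h x * u x) + (fun x => h x * v x)); first exact: EL.
  by apply/funext => x; rewrite mulrDr; congr (_ + _); rewrite !cscaleE mulrCA.
suff : eigenspan `<=` V f by apply.
apply: linear_span_min => // h bh; rewrite /V/=.
rewrite (_ : (fun x => _) = (fun x => h x * f x)); last by apply/funext => x; rewrite mulrC.
suff : eigenspan `<=` V h by apply.
apply: linear_span_min => // k bk; apply: sub_linear_span.
exact: bounded_eigenfunctionM.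
Qed.

(** Conjugation is only semilinear, but the functions whose conjugate lies in the span still form a
    subspace. *)
Lemma eigenspanJ f : eigenspan f -> eigenspan (fun x => conjc (f x)).
Proof.
have [E0 EL] := eigenspan_subspace.
suff : eigenspan `<=` [set g | eigenspan (fun x => conjc (g x))] by apply.
apply: linear_span_min; last first.
  by move=> h bh; apply: sub_linear_span; exact: bounded_eigenfunctionJ.
split; first by rewrite /= (_ : (fun x => _) = 0)//; apply/funext => x; exact: (@conjc0 R).
move=> a u v Vu Vv /=.
rewrite (_ : (fun x => _) =
  conjc a *: (fun x => conjc (u x) : Cplx R) + (fun x => conjc (v x))); first exact: EL.
by apply/funext => x; rewrite rmorphD; congr (_ + _); rewrite !cscaleE rmorphM.
Qed.

(** [eigenfunction] excludes null functions, but the zero element of the span is at energy 0 from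
    them. *)
Lemma ae_eq_Hpp0 h : L2 m h -> (h : borel X -> Cplx R) = cst 0 %[ae m] ->
  Hpp m (koopman alpha) h.
Proof.
move=> /L2P[mh eh] h0; apply/L2closureP; split; first exact/L2P.
move=> e e0; exists 0.
  by have [] := linear_span_subspace (eigenfunction m (koopman alpha)).
by rewrite subr0 (@ae_eq_energy _ _ m h 0)// energy0 lee_fin (ltW e0).
Qed.

(** Each closure contains the generators of the other span; being closed subspaces, the two
    coincide. *)
Lemma HppE : Hpp m (koopman alpha) = L2closure m eigenspan.
Proof.
have eL : linear_span (eigenfunction m (koopman alpha)) `<=` L2 m.
  by apply: linear_span_min; [exact: L2_subspace|move=> h []].
have sH : is_subspace (Hpp m (koopman alpha) : set (X -> Cplx R)).
  by apply: L2closure_subspace => //; exact: linear_span_subspace.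
have sD : is_subspace (L2closure m eigenspan).
  by apply: L2closure_subspace; [exact: eigenspan_L2|exact: eigenspan_subspace].
apply/seteqP; split=> f.
- suff eD : linear_span (eigenfunction m (koopman alpha)) `<=` L2closure m eigenspan.
    move=> /L2closureP[fL fapp]; apply: (L2closureK eigenspan_L2); apply/L2closureP.
    by split=> // e /fapp[g /eD Dg]; exists g.
  apply: linear_span_min => // h eh; have [hL _ _] := eh.
  have [mh hy] := (L2P _ _).1 hL.
  (* An eigenfunction is the limit of its truncations, which are bounded eigenfunctions; the squared
     error is at most [sqnorm (h x)], integrable because [h] is in L^2. *)
  apply: (@L2closure_dominated _ _ m _ (fun n x => truncate n%:R (h x)) h
    (fun x => sqnorm (h x))).
  + exact: eigenspan_L2.
  + exact: hL.
  + move=> n; apply: sub_L2closure; first exact: eigenspan_L2.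
    by apply: sub_linear_span; exact: truncate_eigenfunction.
  + apply/integrableP; split; first exact: measurable_sqnorm.
    by under eq_integral do rewrite gee0_abs ?lee_fin ?sqnorm_ge0//.
  + by move=> n x; exact: sqnorm_sub_truncate.
  + by move=> x; exact: truncate_cvg.
- suff eD : eigenspan `<=` Hpp m (koopman alpha).
    move=> /L2closureP[fL fapp]; apply: (L2closureK eL); apply/L2closureP.
    by split=> // e /fapp[g /eD Hg]; exists g.
  apply: linear_span_min => // h [mh [C hC] hchi].
  have hL : L2 m h := L2_bounded m mh hC.
  (* A bounded eigenfunction may vanish almost everywhere, and is then not an [eigenfunction]. *)
  have [h0|h0] := pselect ((h : borel X -> Cplx R) = cst 0 %[ae m]).
    exact: ae_eq_Hpp0.
  by apply: sub_L2closure => //; exact: sub_linear_span.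
Qed.

End BoundedEigenfunctions.

(** * Polynomial approximation of a step function *)

Section StepApproximation.
Variable R : realType.

(** Induction: the nonnegative factor [1 + a] times the bound for [n] exceeds the next bound by
    [n * a ^+ 2]. *)
Lemma bernoulli_ineq (a : R) n : -1 <= a -> 1 + n%:R * a <= (1 + a) ^+ n.
Proof.
move=> a1; elim: n => [|n ih]; first by rewrite mul0r addr0 expr0.
rewrite exprS; apply: (@le_trans _ _ ((1 + a) * (1 + n%:R * a))); last first.
  by rewrite ler_wpM2l//; lra.
rewrite -natr1 mulrDr mulr1 mulrDl mul1r.
have : 0 <= n%:R * a ^+ 2 by rewrite mulr_ge0 ?sqr_ge0.
by rewrite expr2 => ?; lra.
Qed.

Lemma cvg_natr_expr (s : R) : 0 <= s -> s < 1 -> n%:R * s ^+ n @[n --> \oo] --> (0 : R).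
Proof.
rewrite le_eqVlt => /predU1P[<- _|s0 s1].
  apply: cvg_near_cst; apply: nearW => -[|n]; first by rewrite mul0r.
  by rewrite exprS mul0r mulr0.
(* Half of the decay is spent on the factor [n]: Bernoulli's inequality for [d] bounds [n * r ^+ n]
   by [d^-1], and a factor [r ^+ n] remains. *)
pose r := Num.sqrt s.
have r0 : 0 < r by rewrite sqrtr_gt0.
have rE : r ^+ 2 = s by rewrite sqr_sqrtr ?ltW.
have r1 : r < 1 by rewrite -(@ltr_pXn2r _ 2)// ?nnegrE ?ltW// expr1n rE.
pose d := r^-1 - 1.
have d0 : 0 < d by rewrite subr_gt0 invf_gt1.
apply: (@squeeze_cvgr _ _ _ _ (fun=> 0) (fun n => d^-1 * r ^+ n)).
- apply: nearW => n; have rn := exprn_gt0 n r0.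
  apply/andP; split; first by rewrite mulr_ge0// exprn_ge0// ltW.
  rewrite -rE exprAC expr2 mulrA ler_pM2r// -ler_pdivlMr// mulrC ler_pdivlMr//.
  have := @bernoulli_ineq d n; rewrite [1 + d]addrC subrK exprVn.
  by move=> /(_ ltac:(lra)); lra.
- exact: cvg_cst.
- rewrite -[X in _ --> X](mulr0 d^-1); apply: cvgMr.
  by apply: cvg_expr; rewrite ger0_norm ?ltW.
Qed.

(** The exponent is chosen so that its product with [t ^+ n] is [n * (2 * t) ^+ n], which tends to 0
    below 1/2 and is at least [n] from 1/2 on. *)
Lemma step_cvg (t : R) : 0 <= t -> t <= 1 ->
  (if t < 2^-1 then 1 else 0) - (1 - t ^+ n) ^+ (n * 2 ^ n) @[n --> \oo] --> (0 : R).
Proof.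
move=> t0 t1.
have tn n : 0 <= t ^+ n <= 1 by rewrite exprn_ge0//= exprn_ile1.
have NE n : (n * 2 ^ n)%:R * t ^+ n = n%:R * (2 * t) ^+ n :> R.
  by rewrite natrM natrX exprMn mulrA.
case: ifPn => [t2|].
  (* Bernoulli's inequality bounds the deviation from 1 by that product. *)
  apply: (@squeeze_cvgr _ _ _ _ (fun=> 0) (fun n => n%:R * (2 * t) ^+ n)).
  - apply: nearW => n; have /andP[tn0 tn1] := tn n.
    rewrite subr_ge0 exprn_ile1 ?subr_ge0//= ?gerBl//= -NE.
    have := @bernoulli_ineq (- t ^+ n) (n * 2 ^ n).
    by rewrite mulrN => /(_ ltac:(lra)); lra.
  - exact: cvg_cst.
  - by apply: cvg_natr_expr; lra.
rewrite -leNgt => t2.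
apply: (@squeeze_cvgr _ _ _ _ (fun n => - n.+1%:R^-1) (fun=> 0)).
- apply: nearW => n; have /andP[tn0 tn1] := tn n.
  rewrite sub0r oppr_le0 exprn_ge0 ?subr_ge0// andbT lerN2.
  rewrite -[leRHS]mul1r ler_pdivlMr//.
  (* The extra factor is at least [n + 1] by Bernoulli's inequality, while the whole product is a
     power of [(1 - t ^+ n) * (1 + t ^+ n)], hence at most 1. *)
  apply: (@le_trans _ _ ((1 - t ^+ n) ^+ (n * 2 ^ n) * (1 + t ^+ n) ^+ (n * 2 ^ n))).
    rewrite ler_wpM2l ?exprn_ge0 ?subr_ge0//.
    apply: le_trans (bernoulli_ineq _ _); last by lra.
    rewrite NE -natr1 addrC lerD2l -[leLHS]mulr1 ler_wpM2l//.
    by rewrite exprn_ege1//; lra.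
  by rewrite -exprMn exprn_ile1//; nra.
- by rewrite -oppr0; apply: cvgN; exact: cvg_harmonic.
- exact: cvg_cst.
Qed.

End StepApproximation.

(** * Compactness and continuity *)

Section CompactInduction.
Variable X : ptopologicalType.

(** Finitely many interiors of the local sets cover [K], and [W] is stable under finite unions. *)
Lemma compact_induction (K : set X) (W : set (set X)) : compact K ->
  W set0 -> (forall A B, W A -> W B -> W (A `|` B)) ->
  (forall x, K x -> exists2 E, W E & nbhs x E) ->
  exists2 E, W E & K `<=` E.
Proof.
rewrite compact_cover => cK W0 WU WK.
(* Outside [K] the choice defaults to the empty set; the finite subcover is indexed by points of
   [K]. *)
have /choice[F FP] x : exists E, K x -> W E /\ nbhs x E.
  have [/WK[E WE xE]|nKx] := pselect (K x); first by exists E.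
  by exists set0.
have [|x Kx|D DK Kcov] := cK X K (fun x => (F x)^°).
- by move=> x _; exact: open_interior.
- by exists x => //; apply: nbhs_singleton; apply: nbhs_interior; case: (FP x Kx).
exists (\bigcup_(x in [set` D]) F x).
  rewrite bigcup_fset big_seq; apply: big_ind => // x xD.
  by have /set_mem/FP[] := DK x xD.
by move=> x /Kcov[y Dy Fy]; exists y => //; exact: interior_subset.
Qed.

End CompactInduction.

(** * Continuous complex functions: measurability and boundedness *)

Section ContinuousComplex.
Variables (R : realType) (X : ptopologicalType).
Implicit Types f : X -> Cplx R.

Lemma continuous_Re f : continuous f -> continuous (fun x => complex.Re (f x) : R).
Proof.
move=> cf x; apply/cvgrPdist_le => e e0.
have /cvgrPdist_le/(_ (e%:C)%C) := cf x; rewrite ltcR => /(_ e0).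
apply: filterS => y /= ye; rewrite -lecR; apply: le_trans ye.
by have := normc_ge_Re (f x - f y); case: (f x) (f y) => [? ?] [? ?].
Qed.

Lemma continuous_Im f : continuous f -> continuous (fun x => complex.Im (f x) : R).
Proof.
move=> cf.
have -> : (fun x => complex.Im (f x) : R) = (fun x => complex.Re (- 'i%C * f x)).
  by apply/funext => x; case: (f x) => a b /=; ring.
apply: continuous_Re => x; apply: (@cvgM R[i]); first exact: cvg_cst.
exact: cf.
Qed.

Lemma continuous_real (u : X -> R) : continuous u ->
  continuous (fun x => (u x)%:C%C : Cplx R).
Proof.
move=> cu x; apply/cvgrPdist_le => e.
rewrite ltcE => /andP[/eqP/= e0 e1].
have /cvgrPdist_le/(_ _ e1) := cu x; apply: filterS => y /=.
rewrite -rmorphB normc_def/= expr0n addr0 sqrtr_sqr => ye.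
by rewrite lecE/= e0 eqxx.
Qed.

Lemma continuous_borel_measurable (u : X -> R) : continuous u ->
  measurable_fun [set: borel X] (u : borel X -> R).
Proof.
move=> /continuousP cu; apply: (measurability _ (RGenOInfty.measurableE R)) => //.
move=> /= _ [_ [a ->] <-]; rewrite setTI; apply: sub_sigma_algebra.
exact/cu/interval_open.
Qed.

Lemma continuous_bounded (u : X -> R) : compact [set: X] -> continuous u ->
  exists2 C : R, 0 < C & forall x, `|u x| <= C.
Proof.
move=> cX cu.
have /compact_bounded[M [Mr MP]] : compact (u @` [set: X]).
  by apply: continuous_compact => //; exact: continuous_subspaceT.
(* Every number above [M] is a bound; this one is also positive. *)
exists (`|M| + 1); first by rewrite ltr_wpDl.
move=> x; apply: MP; last by exists x.
by rewrite (le_lt_trans (ler_norm M)) ?ltrDl.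
Qed.

Lemma continuous_cmeasurable f : continuous f -> cmeasurable f.
Proof.
move=> cf; split; apply: continuous_borel_measurable.
  exact: continuous_Re.
exact: continuous_Im.
Qed.

Lemma continuous_L2 (m : probability (borel X) R) f :
  compact [set: X] -> continuous f -> L2 m f.
Proof.
move=> cX cf.
have [C C0 fC] := continuous_bounded cX (continuous_Re cf).
have [C' C'0 fC'] := continuous_bounded cX (continuous_Im cf).
apply: (@L2_bounded _ _ m _ (C ^+ 2 + C' ^+ 2)); first exact: continuous_cmeasurable.
move=> x; rewrite /sqnorm -[_ ^+ 2](real_normK (num_real _)).
rewrite -[X in _ + X <= _](real_normK (num_real _)).
by rewrite lerD// ler_pXn2r// ?nnegrE ?ltW.
Qed.

End ContinuousComplex.

(** * The algebra of sets with pure point indicator *)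

(** Meant for [c] the measure of a set, with [a] and [b] those of an outer and an inner
    approximation. *)
Lemma lee_sub_half (R : realFieldType) (a b c : \bar R) (e : R) :
  a \is a fin_num -> b \is a fin_num -> c \is a fin_num ->
  (a < c + (e / 2)%:E)%E -> (c - (e / 2)%:E < b)%E -> (a - b <= e%:E)%E.
Proof.
case: a b c => [a| |] [b| |] [c| |]//= _ _ _.
by rewrite -EFinD -!EFinB !lte_fin lee_fin; lra.
Qed.

Section PurePointAlgebra.
Variables (R : realType) (X : ptopologicalType).
Variable m : probability (borel X) R.
Variables (G : topologicalZmodType) (alpha : G -> X -> X).
Implicit Types (f g h : X -> Cplx R) (u v : X -> R) (A B E : set X).

(** By [HppE] this is the pure point space; the description by bounded eigenfunctions makes products
    available. *)
Let D : set (X -> Cplx R) := L2closure m (eigenspan m alpha).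
Let SL := @eigenspan_L2 R X m G alpha.

Definition real_fun u : X -> Cplx R := fun x => (u x)%:C%C.

Lemma pp_subspace : is_subspace D.
Proof. by apply: L2closure_subspace; [exact: SL|exact: eigenspan_subspace]. Qed.

Lemma pp_cmeasurable f : D f -> cmeasurable f.
Proof. by move=> /L2closureP[/L2P[]]. Qed.

(** Approximate [g] first, then [f]: each time the factor that is kept is
    bounded. *)
Lemma ppM f g (C : R) : (forall x, sqnorm (f x) <= C) ->
  D f -> D g -> D (fun x => f x * g x).
Proof.
have mulE h k : (fun x => h x * k x) = (fun x => k x * h x) :> (X -> Cplx R).
  by apply/funext => x; rewrite mulrC.
have mul_approx h k (c : R) : (forall x, sqnorm (h x) <= c) -> cmeasurable h -> D k ->
    (forall s, eigenspan m alpha s -> D (fun x => h x * s x)) ->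
    D (fun x => h x * k x).
  move=> hc mh /L2closureP[kL kapp] hS.
  have c0 : 0 <= c := le_trans (sqnorm_ge0 (h point)) (hc point).
  have c1 : 0 < c + 1 by rewrite ltr_wpDl.
  have hc1 x : sqnorm (h x) <= c + 1 by rewrite ler_wpDr.
  have [mk ek] := (L2P _ _).1 kL.
  apply: (L2closureK SL); apply/L2closureP; split.
    apply/L2P; split; first exact: cmeasurableM.
    apply: (@le_lt_trans _ _ (c%:E * energy m k)%E).
      by apply: le_energy => //;
        [exact: cmeasurableM|move=> x; rewrite sqnormM ler_wpM2r ?sqnorm_ge0].
    by apply: lte_mul_pinfty.
  move=> e e0; have [s Ss ks] := kapp (e / (c + 1)) ltac:(by rewrite divr_gt0).
  exists (fun x => h x * s x); first exact: hS.
  rewrite (_ : _ - _ = (fun x => h x * (k - s) x)); last first.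
    by apply/funext => x; rewrite mulrBr.
  have mks : cmeasurable (k - s).
    by apply: cmeasurableB => //; case: (eigenspan_bounded Ss).
  by have := energyM_le mh mks (ltW c1) hc1 ks; rewrite mulrC divfK ?gt_eqF.
move=> fC Df Dg; apply: (mul_approx _ _ _ fC (pp_cmeasurable Df) Dg) => s Ss.
have [ms [c sc]] := eigenspan_bounded Ss.
rewrite mulE; apply: (mul_approx _ _ _ sc ms Df) => t St.
by apply: (sub_L2closure SL); exact: eigenspanM.
Qed.

(** Conjugation preserves both the energy and [eigenspan]. *)
Lemma ppJ f : D f -> D (fun x => conjc (f x)).
Proof.
move=> /L2closureP[/L2P[mf ef] fapp].
have EJ h : energy m (fun x => conjc (h x)) = energy m h.
  by apply: eq_integral => x _; rewrite sqnormJ.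
apply/L2closureP; split; first by apply/L2P; rewrite EJ; split=> //; exact: cmeasurableJ.
move=> e /fapp[g Sg fg]; exists (fun x => conjc (g x)); first exact: eigenspanJ.
rewrite (_ : _ - _ = (fun x => conjc ((f - g) x))) ?EJ//.
by apply/funext => x; rewrite rmorphB.
Qed.

Lemma pp_cst (c : R[i]) : D (fun=> c).
Proof.
rewrite (_ : (fun=> c) = c *: (fun=> 1 : Cplx R)); last first.
  by apply/funext => x; rewrite cscaleE mulr1.
apply: subspaceZ; first exact: pp_subspace.
by apply: (sub_L2closure SL); apply: sub_linear_span; exact: bounded_eigenfunction1.
Qed.

Lemma pp_Re f : D f -> D (real_fun (fun x => complex.Re (f x))).
Proof.
move=> Df.
rewrite (_ : real_fun _ = 2^-1 *: (f + (fun x => conjc (f x)))); last first.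
  by apply/funext => x; rewrite cscaleE /real_fun ReJ_add mulrC.
by apply: (subspaceZ pp_subspace); apply: (subspaceD pp_subspace) => //; exact: ppJ.
Qed.

Lemma pp_Im f : D f -> D (real_fun (fun x => complex.Im (f x))).
Proof.
move=> Df.
rewrite (_ : real_fun _ = ('i%C / 2) *: ((fun x => conjc (f x)) - f)); last first.
  by apply/funext => x; rewrite cscaleE /real_fun ImJ_sub mulrC mulrA mulrAC.
by apply: (subspaceZ pp_subspace); apply: (subspaceB pp_subspace) => //; exact: ppJ.
Qed.

Definition pp_set E := D (cindic E).

Lemma pp_set_measurable E : pp_set E -> measurable (E : set (borel X)).
Proof.
move=> /pp_cmeasurable/cmeasurable_real mE.
by apply/(@measurable_indicP _ (borel X) R).
Qed.

Lemma sqnorm_cindic_le1 E x : sqnorm (cindic E x : R[i]) <= 1.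
Proof.
have [Ex|nEx] := pselect (E x); first by rewrite cindicT ?sqnorm1.
by rewrite cindicF ?sqnorm0.
Qed.

Lemma pp_set0 : pp_set set0.
Proof.
rewrite /pp_set (_ : cindic _ = 0); first by case: pp_subspace.
by apply/funext => x; rewrite cindicF.
Qed.

Lemma pp_setC E : pp_set E -> pp_set (~` E).
Proof.
move=> DE; rewrite /pp_set (_ : cindic _ = (fun=> 1) - cindic E).
  by apply: (subspaceB pp_subspace) => //; exact: pp_cst.
apply/funext => x; rewrite -[RHS]/(1 - cindic E x).
have [Ex|nEx] := pselect (E x); first by rewrite cindicF ?cindicT ?subrr//; exact.
by rewrite cindicT ?cindicF ?subr0.
Qed.

(** The indicator of the intersection is the product, to which [ppM] applies because indicators are
    bounded. *)
Lemma pp_setI A B : pp_set A -> pp_set B -> pp_set (A `&` B).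
Proof.
move=> DA DB; rewrite /pp_set (_ : cindic _ = (fun x => cindic A x * cindic B x)).
  exact: ppM (sqnorm_cindic_le1 A) DA DB.
apply/funext => x; have [Ax|nAx] := pselect (A x); last first.
  by rewrite !(cindicF (E := A)) ?mul0r ?cindicF// => -[].
have [Bx|nBx] := pselect (B x); first by rewrite !cindicT ?mulr1.
by rewrite !(cindicF (E := B)) ?mulr0 ?cindicF// => -[].
Qed.

Lemma pp_setU A B : pp_set A -> pp_set B -> pp_set (A `|` B).
Proof.
move=> DA DB; rewrite -[_ `|` _]setCK setCU.
by apply: pp_setC; apply: pp_setI; exact: pp_setC.
Qed.

Lemma ppX f (C : R) n : 0 <= C -> (forall x, sqnorm (f x) <= C) ->
  D f -> D (fun x => f x ^+ n).
Proof.
move=> C0 fC Df; elim: n => [|n ih].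
  by rewrite (_ : (fun _ => _) = (fun=> 1)); [exact: pp_cst|].
rewrite (_ : (fun _ => _) = (fun x => f x * f x ^+ n)); first exact: ppM fC Df ih.
by apply/funext => x; rewrite exprS.
Qed.

(** The polynomials [q n] in [v] converge pointwise to the indicator by [step_cvg], with squared
    error at most 1, which is integrable for a probability. *)
Lemma pp_sublevel_half v : (forall x, 0 <= v x <= 1) -> D (real_fun v) ->
  pp_set [set x | v x < 2^-1].
Proof.
move=> v01 Dv.
pose q n t : R := (1 - t ^+ n) ^+ (n * 2 ^ n).
have mv : measurable_fun [set: borel X] (v : borel X -> R).
  by apply/cmeasurable_real; exact: pp_cmeasurable Dv.
have q01 n x : 0 <= q n (v x) <= 1.
  have /andP[v0 v1] := v01 x; have vn : 0 <= v x ^+ n <= 1.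
    by rewrite exprn_ge0//= exprn_ile1.
  by rewrite /q exprn_ge0 ?exprn_ile1//=; lra.
have Dq n : D (real_fun (fun x => q n (v x))).
  rewrite (_ : real_fun _ = (fun x => (1 - real_fun v x ^+ n) ^+ (n * 2 ^ n))); last first.
    by apply/funext => x; rewrite /real_fun /q !(rmorphXn, rmorphB, rmorph1).
  apply: (@ppX _ 1) => // [x|].
    rewrite -rmorphXn -(rmorph1 (real_complex R)) -rmorphB sqnorm_real.
    have /andP[v0 v1] := v01 x; have vn : 0 <= v x ^+ n <= 1.
      by rewrite exprn_ge0//= exprn_ile1.
    by rewrite exprn_ile1//; lra.
  apply: (subspaceB pp_subspace (f := fun=> 1) (g := fun x => real_fun v x ^+ n)).
    exact: pp_cst.
  apply: (@ppX _ 1) => // x; rewrite sqnorm_real; have /andP[v0 v1] := v01 x.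
  by rewrite exprn_ile1.
have sqE n x : sqnorm (cindic [set x | v x < 2^-1] x - real_fun (fun x => q n (v x)) x) =
    ((if v x < 2^-1 then 1 else 0) - q n (v x)) ^+ 2.
  rewrite -sqnorm_real rmorphB; congr (sqnorm (_ - _)).
  by case: ifPn => vx; [rewrite cindicT|rewrite cindicF//; exact/negP].
apply: (@L2closure_dominated _ _ m _ (fun n => real_fun (fun x => q n (v x))) _ (fun=> 1)).
- exact: SL.
- apply: (L2_bounded m _ (sqnorm_cindic_le1 _)); apply: cmeasurable_indic.
  exact: measurable_strict_sublevel.
- exact: Dq.
- exact: finite_measure_integrable_cst.
- move=> n x; rewrite sqE; have := q01 n x.
  by case: ifPn => _ ?; rewrite -[leRHS](expr1n _ 2) -ler_sqrt ?sqr_ge0//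
    !sqrtr_sqr normr1 ler_norml; lra.
- move=> x; under eq_fun do rewrite sqE expr2.
  have /andP[v0 v1] := v01 x.
  have c0 := step_cvg v0 v1; have := cvgM c0 c0; rewrite mulr0; exact.
Qed.

Lemma pp_sublevel u (C c : R) : 0 < C -> (forall x, `|u x| <= C) ->
  D (real_fun u) -> pp_set [set x | u x < c].
Proof.
(* The distance from [u x] to [c] is at most [k / 2], so this affine change of variable sends [c] to
   1/2 and the range of [u] into [0, 1]. *)
move=> C0 uC Du; pose k := 2 * (C + `|c|).
have k0 : 0 < k by rewrite mulr_gt0// ltr_wpDr.
rewrite (_ : [set x | u x < c] = [set x | 2^-1 + k^-1 * (u x - c) < 2^-1]); last first.
  by apply/seteqP; split => x /=; rewrite gtrDl pmulr_rlt0 ?invr_gt0// subr_lt0.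
apply: pp_sublevel_half.
  move=> x; have := uC x; have := ler_norm c; have := ler_norm (- c).
  rewrite normrN ler_norml => c1 c2 /andP[u1 u2].
  have : `|k^-1 * (u x - c)| <= 2^-1.
    rewrite normrM gtr0_norm ?invr_gt0// mulrC ler_pdivrMr// mulrA mulVf// mul1r.
    by rewrite ler_norml; lra.
  by rewrite ler_norml => /andP[a1 a2]; lra.
rewrite (_ : real_fun _ =
  (2^-1 - k^-1 * c)%:C%C *: (fun=> 1 : Cplx R) + (k^-1)%:C%C *: real_fun u); last first.
  apply/funext => x; rewrite -[RHS]/((2^-1 - k^-1 * c)%:C%C * 1 + (k^-1)%:C%C * (u x)%:C%C).
  by rewrite mulr1 -rmorphM -rmorphD /real_fun; congr (_%:C%C); ring.
apply: (subspaceD pp_subspace); apply: (subspaceZ pp_subspace) => //.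
exact: pp_cst.
Qed.

(** Both sets lie between [K] and [U], so their indicators agree off the difference of [U] and [K]
    and are at most 1 apart on it. *)
Lemma energy_cindicB E A K U : measurable (E : set (borel X)) ->
  measurable (A : set (borel X)) -> measurable (K : set (borel X)) ->
  measurable (U : set (borel X)) ->
  K `<=` E -> E `<=` U -> K `<=` A -> A `<=` U ->
  (energy m (cindic E - cindic A) <= m (U `\` K))%E.
Proof.
move=> mE mA mK mU KE EU KA AU.
have mUK : measurable (U `\` K : set (borel X)) by exact: measurableD.
rewrite -[U `\` K]setIT -integral_indic//.
apply: ge0_le_integral => //.
- by move=> x _; rewrite lee_fin sqnorm_ge0.
- by apply: measurable_sqnorm; apply: cmeasurableB; exact: cmeasurable_indic.
- by apply/measurable_EFinP; exact: measurable_indic.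
- move=> x _; rewrite lee_fin -[_ x]/(cindic E x - cindic A x).
  have [Kx|nKx] := pselect (K x).
    by rewrite (cindicT (KE _ Kx)) (cindicT (KA _ Kx)) subrr sqnorm0 indicE.
  have [Ux|nUx] := pselect (U x); last first.
    rewrite !cindicF ?subrr ?sqnorm0 ?indicE//; first by move=> /AU.
    by move=> /EU.
  rewrite indicE mem_set//.
  have [Ex|nEx] := pselect (E x); have [Ax|nAx] := pselect (A x);
    rewrite ?(cindicT Ex) ?(cindicF nEx) ?(cindicT Ax) ?(cindicF nAx);
    by rewrite ?subrr ?subr0 ?sub0r ?sqnormN ?sqnorm0 ?sqnorm1.
Qed.

(** Regularity encloses [A] between a compact [K] and an open [U] of almost equal measure; a pure
    point set separating [K] from the complement of [U] then approximates [A]. *)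
Lemma pp_set_regular : regular_measure m ->
  (forall K F : set X, compact K -> closed F -> K `&` F = set0 ->
     exists2 E, pp_set E & K `<=` E /\ E `&` F = set0) ->
  forall A, measurable (A : set (borel X)) -> pp_set A.
Proof.
move=> reg sep A mA; apply: (L2closureK SL); apply/L2closureP; split.
  by apply: (L2_bounded m _ (sqnorm_cindic_le1 _)); exact: cmeasurable_indic.
move=> e e0; have e20 : 0 < e / 2 by rewrite divr_gt0.
have mAfin : m A \is a fin_num by exact: fin_num_measure.
have [Ainf Asup] := reg A mA.
(* [eq_ind] transports the finiteness of [m A] to the infimum equal to it, and likewise to the
   supremum below. *)
have [_ [U [oU AU] <-] mUlt] := lb_ereal_inf_adherent e20
  (eq_ind _ (fun z => z \is a fin_num) mAfin _ Ainf).
have [_ [K [cK [mK KA]] <-] mKgt] := ub_ereal_sup_adherent e20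
  (eq_ind _ (fun z => z \is a fin_num) mAfin _ Asup).
rewrite -Ainf in mUlt; rewrite -Asup in mKgt.
have mU : measurable (U : set (borel X)) by exact: sub_sigma_algebra.
have [|E DE [KE EU]] := sep K (~` U) cK (open_closedC oU).
  by apply/disjoints_subset; rewrite setCK; exact: subset_trans KA AU.
have mE := pp_set_measurable DE.
have {}EU : E `<=` U by move/disjoints_subset : EU; rewrite setCK.
exists (cindic E) => //.
apply: (@le_trans _ _ (m (U `\` K))).
  by apply: energy_cindicB => //; exact: subset_trans KA AU.
rewrite measureD//; last by rewrite ltey_eq fin_num_measure.
rewrite setIidr; last exact: subset_trans KA AU.
have mUfin : m U \is a fin_num by exact: fin_num_measure.
have mKfin : m K \is a fin_num by exact: fin_num_measure.
exact: (lee_sub_half mUfin mKfin mAfin mUlt mKgt).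
Qed.

(** Simple functions approximating [u] from below are finite combinations of indicators; the squared
    error is bounded by [u ^+ 2], integrable since [u] is in L^2. *)
Lemma pp_nnreal u : (forall x, 0 <= u x) -> L2 m (real_fun u) ->
  (forall A, measurable (A : set (borel X)) -> pp_set A) -> D (real_fun u).
Proof.
move=> u0 uL allpp; have [/cmeasurable_real mu eu] := (L2P _ _).1 uL.
have mEu : measurable_fun [set: borel X] (fun x : borel X => (u x)%:E).
  exact/measurable_EFinP.
pose s_ n := nnsfun_approx (@measurableT _ (borel X)) mEu n.
pose s n : X -> R := s_ n.
have su n x : s n x <= u x.
  rewrite -lee_fin /s /s_ nnsfun_approxE; apply: le_approx => // y _.
  by rewrite lee_fin.
have Ds n : D (real_fun (s n)).
  rewrite (_ : real_fun _ = \sum_(i < size (finmap.enum_fset (fset_set (range (s_ n)))))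
     ((finmap.enum_fset (fset_set (range (s_ n))))`_i)%:C%C *:
       cindic (s n @^-1` [set (finmap.enum_fset (fset_set (range (s_ n))))`_i])).
    apply: subspace_sum; first exact: pp_subspace.
    by move=> i; apply: subspaceZ; [exact: pp_subspace|exact: allpp].
  apply/funext => x; rewrite /real_fun /s fimfunEord rmorph_sum fct_sumE.
  by apply: eq_bigr => i _; rewrite rmorphM.
apply: (@L2closure_dominated _ _ m _ (fun n => real_fun (s n)) _ (fun x => u x ^+ 2)).
- exact: SL.
- exact: uL.
- exact: Ds.
- apply/integrableP; split; first by apply/measurable_EFinP; exact: measurable_funX.
  under eq_integral do rewrite gee0_abs ?lee_fin ?sqr_ge0// -sqnorm_real.
  exact: eu.
- move=> n x; rewrite -rmorphB sqnorm_real ler_pXn2r// ?nnegrE ?subr_ge0//.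
  by rewrite gerBl; exact: (@fun_ge0 _ _ (s_ n) x).
- move=> x; under eq_fun do rewrite -rmorphB sqnorm_real expr2.
  have cs : s n x @[n --> \oo] --> u x.
    have /fine_cvgP[_] := @cvg_nnsfun_approx _ _ _ _ (@measurableT _ (borel X)) _ mEu
      (fun x _ => u0 x) x Logic.I.
    exact.
  have c0 : u x - s n x @[n --> \oo] --> (0 : R).
    by have := cvgB (cvg_cst (u x)) cs; rewrite subrr; exact.
  by have := cvgM c0 c0; rewrite mulr0; exact.
Qed.

(** Splitting into real and imaginary parts, then into positive and negative parts, reduces to
    [pp_nnreal]. *)
Lemma pp_all : (forall A, measurable (A : set (borel X)) -> pp_set A) ->
  L2 m `<=` D.
Proof.
move=> allpp.
have ppreal u : L2 m (real_fun u) -> D (real_fun u).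
  move=> uL; have [/cmeasurable_real mu eu] := (L2P _ _).1 uL.
  (* Applied below to the positive and negative parts of [u], whose domination by the modulus of [u]
     makes them square-integrable. *)
  have mp v : measurable_fun [set: borel X] (v : borel X -> R) ->
      (forall x, 0 <= v x <= `|u x|) -> D (real_fun v).
    move=> mv vu; apply: pp_nnreal => //.
      by move=> x; case/andP: (vu x).
    apply/L2P; split; first exact/cmeasurable_real.
    apply: le_lt_trans eu; rewrite -[leRHS]mul1e; apply: le_energy => //.
    move=> x; rewrite mul1r !sqnorm_real -[leRHS]real_normK ?num_real//.
    by have /andP[v0 vx] := vu x; rewrite ler_pXn2r// ?nnegrE.
  rewrite (_ : real_fun u = real_fun (fun x => Num.max (u x) 0) -
                            real_fun (fun x => Num.max (- u x) 0)); last first.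
    apply/funext => x; rewrite -[RHS]/((Num.max (u x) 0)%:C%C - (Num.max (- u x) 0)%:C%C).
    rewrite -rmorphB; congr (_%:C%C).
    by have [ux|ux] := lerP (u x) 0; have [vx|vx] := lerP (- u x) 0; lra.
  apply: (subspaceB pp_subspace); apply: mp.
  - by apply: measurable_maxr.
  - by move=> x; rewrite le_max lexx orbT ge_max ler_norm normr_ge0.
  - by apply: measurable_maxr => //; exact: measurable_funN.
  - by move=> x; rewrite le_max lexx orbT ge_max -normrN ler_norm normr_ge0.
move=> f fL; have [[mr mi] ef] := (L2P _ _).1 fL.
rewrite (_ : f = real_fun (fun x => complex.Re (f x)) +
                 'i%C *: real_fun (fun x => complex.Im (f x))); last first.
  by apply/funext => x; exact: complexE.
have part u : measurable_fun [set: borel X] (u : borel X -> R) ->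
    (forall x, u x ^+ 2 <= sqnorm (f x)) -> D (real_fun u).
  move=> mu uf; apply: ppreal; apply/L2P; split; first exact/cmeasurable_real.
  apply: le_lt_trans ef; rewrite -[leRHS]mul1e; apply: le_energy => //.
  by move=> x; rewrite mul1r sqnorm_real.
apply: (subspaceD pp_subspace); [|apply: (subspaceZ pp_subspace)]; apply: part => // x.
- by rewrite lerDl sqr_ge0.
- by rewrite lerDr sqr_ge0.
Qed.

End PurePointAlgebra.

(** * Separation of points and of compact sets by pure point sets *)

Section Separation.
Variables (R : realType) (X : ptopologicalType).
Variable m : probability (borel X) R.
Variables (G : topologicalZmodType) (alpha : G -> X -> X).
Hypothesis cX : compact [set: X].

Let D : set (X -> Cplx R) := L2closure m (eigenspan m alpha).

(** The sublevel set at the midpoint of the two values is pure point; exchanging the two points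
    amounts to taking complements. *)
Lemma pp_separate_real (u : X -> R) (x y : X) : continuous u ->
  D (real_fun u) -> u x != u y ->
  exists2 E, pp_set m alpha E & nbhs x E /\ nbhs y (~` E).
Proof.
move=> cu Du; wlog uxy : x y / u x < u y.
  move=> wl; rewrite neq_lt => /orP[uxy|uyx]; first by apply: wl => //; rewrite lt_eqF.
  have [E DE [yE xE]] := wl y x uyx ltac:(by rewrite lt_eqF).
  by exists (~` E); [exact: pp_setC|rewrite setCK].
move=> _; have [C C0 uC] := continuous_bounded cX cu.
pose c := (u x + u y) / 2.
exists [set z | u z < c]; first exact: pp_sublevel C0 uC Du.
split; first by apply: (cvgr_lt (u x) (cu x)); rewrite /c; lra.
have : \forall z \near y, c < u z by apply: (cvgr_gt (u y) (cu y)); rewrite /c; lra.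
by apply: filterS => z cz /=; apply/negP; rewrite -leNgt ltW.
Qed.

Variable V : set (X -> Cplx R).
Hypotheses (VD : V `<=` D) (Vc : forall f, V f -> continuous f).
Hypothesis Vsep : separates_points V.

Lemma pp_separate_points (x y : X) : x <> y ->
  exists2 E, pp_set m alpha E & nbhs x E /\ nbhs y (~` E).
Proof.
move=> /Vsep[f Vf /eqP]; rewrite eq_complex negb_and => /orP[].
- by apply: (pp_separate_real (u := fun x => complex.Re (f x)));
    [apply: continuous_Re; exact: Vc|apply: pp_Re; exact: VD].
- by apply: (pp_separate_real (u := fun x => complex.Im (f x)));
    [apply: continuous_Im; exact: Vc|apply: pp_Im; exact: VD].
Qed.

(** The usual separation of compact sets in a Hausdorff space, run inside the algebra of pure point
    sets: first a point of [K] from [F], then [K] from [F]. *)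
Lemma pp_separate_compact (K F : set X) : compact K -> closed F -> K `&` F = set0 ->
  exists2 E, pp_set m alpha E & K `<=` E /\ E `&` F = set0.
Proof.
move=> cK /subclosed_compact/(_ cX (@subsetT _ F)) cF KF0.
suff sepx x : K x -> exists2 E, pp_set m alpha E /\ E `&` F = set0 & nbhs x E.
  have [|A B [DA AF] [DB BF]|E [DE EF] KE] :=
      compact_induction (W := fun E => pp_set m alpha E /\ E `&` F = set0) cK _ _ sepx.
  - by split; [exact: pp_set0|rewrite set0I].
  - by split; [exact: pp_setU|rewrite setIUl AF BF setU0].
  - by exists E.
move=> Kx.
(* With [x] fixed, a pure point set covers [F] and misses a neighbourhood of [x]; its complement is
   the set sought around [x]. *)
have [||y Fy|E [DE xE] FE] :=
    compact_induction (W := fun E => pp_set m alpha E /\ nbhs x (~` E)) cF.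
- by split; [exact: pp_set0|rewrite setC0; exact: filterT].
- move=> A B [DA xA] [DB xB]; split; first exact: pp_setU.
  by rewrite setCU; exact: filterI.
- have /pp_separate_points[E DE [xE yE]] : x <> y.
    by move=> xy; have : (K `&` F) x by [split=> //; rewrite xy]; rewrite KF0.
  by exists (~` E) => //; split; [exact: pp_setC|rewrite setCK].
- exists (~` E) => //; split; first exact: pp_setC.
  by apply/disjoints_subset; exact: subsetC.
Qed.

End Separation.

(** * Equivalence of pure point spectrum and separation of points *)

Theorem theorem1 (R : realType)
    (G : topologicalZmodType) (Omega : ptopologicalType)
    (alpha : G -> Omega -> Omega) (m : probability (borel Omega) R) :
  hausdorff_space G -> locally_compact [set: G] -> sigma_compact G ->
  hausdorff_space Omega -> compact [set: Omega] ->
  continuous_action alpha ->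
  regular_measure m -> invariant_measure alpha m ->
  Hpp m (koopman alpha) = L2 m
  <->
  exists V : set (Omega -> Cplx R),
    [/\ V `<=` Hpp m (koopman alpha) `&` [set f | continuous f],
        is_subspace V &
        separates_points V].
Proof.
move=> _ _ _ hO cO _ reg _; split.
- move=> ->; exists [set f | continuous f]; split.
  + by move=> f cf; split=> //; exact: continuous_L2.
  + split=> [|a f g cf cg] x /=; first exact: cvg_cst.
    by apply: cvgD; [apply: cvgZr; exact: cf|exact: cg].
  + move=> x y xy; have aO := hausdorff_accessible hO.
    have xy0 : [set x] `&` [set y] = set0 by apply/disjoints_subset => _ -> /= yx; exact: xy.
    (* A compact Hausdorff space is normal and its points are closed, so Urysohn's lemma gives a
       function with values 0 at [x] and 1 at [y]. *)
    have [u [cu ux uy _]] := urysohn_ext_itv (compact_normal hO cO)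
      (@accessible_closed_set1 _ aO x) (@accessible_closed_set1 _ aO y) xy0 (@ltr01 R).
    exists (real_fun u); first exact: continuous_real.
    have u0 : u x = 0 by apply: ux; exists x.
    have u1 : u y = 1 by apply: uy; exists y.
    by rewrite /real_fun u0 u1 => -[] /eqP; rewrite eq_sym oner_eq0.
(* Functions in [Hpp] are square-integrable by definition. The other inclusion follows once all
   Borel sets are pure point, which regularity reduces to separating compact sets from closed
   ones. *)
- move=> [V [VH _ Vsep]]; rewrite HppE; apply/seteqP; split; first by move=> f [].
  apply: pp_all; apply: pp_set_regular => // K F.
  apply: (@pp_separate_compact _ _ _ _ _ cO V) => // f /VH[].
    by rewrite HppE.
  by [].
Qed.
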